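(* Let $(P_i:\underline{X}_i\to\underline{Y}_i)_{i\in I}$ be any set-indexed family of problems. Then $P_j\leq_2\lceil P_i\rceil_{i\in I}$ for every $j\in I$, and whenever $Q$ is a problem with $P_i\leq_2 Q$ for all $i\in I$, then $\lceil P_i\rceil_{i\in I}\leq_2 Q$. Consequently $(\mathbb{P}_2,\leq_2)$ is a complete join-semilattice, the supremum of a set $S$ of elements being the class of $\lceil P\rceil_{P\in S}$ (taking representatives).
   Context: A partial function $F:\subseteq X\to Y$ is a function from $\operatorname{dom}(F)\subseteq X$ to $Y$; between topological spaces it is continuous if continuous on $\operatorname{dom}(F)$ with the subspace topology. A problem $P:\underline{X}\to\underline{Y}$ is a set of partial functions from $\underline{X}$ to $\underline{Y}$. For problems $P:\underline{X}_1\to\underline{Y}_1$, $Q:\underline{X}_2\to\underline{Y}_2$, $P\leq_2 Q$ means there are continuous partial functions $F:\subseteq\underline{X}_1\times\underline{Y}_2\to\underline{Y}_1$ and $G:\subseteq\underline{X}_1\to\underline{X}_2$ such that for every $g\in Q$ the partial function $x\mapsto F(x,g(G(x)))$ (defined exactly where all terms are defined) belongs to $P$. $\mathbb{P}_2$ is the class of equivalence classes of problems under $\leq_2$, partially ordered by $\leq_2$. The coproduct $\coprod_{i\in I}\underline{X}_i$ is $\bigcup_{i\in I}\{i\}\times X_i$ with the smallest topology containing all $\{i\}\times U$, $U$ open in $\underline{X}_i$. For partial functions $f_i:\subseteq\underline{X}_i\to\underline{Y}_i$, $\lceil f_i\rceil_{i\in I}:\subseteq\coprod_i\underline{X}_i\to\coprod_i\underline{Y}_i$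 is $(i,x)\mapsto(i,f_i(x))$ (defined iff $x\in\operatorname{dom}f_i$), and $\lceil P_i\rceil_{i\in I}=\{\lceil f_i\rceil_{i\in I}\mid f_i\in P_i\text{ for all }i\in I\}$. A complete join-semilattice is a partially ordered class in which every subset has a least upper bound. *)

(* Defs.v *)
From HB Require Import structures.
From mathcomp Require Import all_boot all_order all_algebra.
From mathcomp Require Import all_classical topology.

Set Implicit Arguments.
Unset Strict Implicit.
Unset Printing Implicit Defensive.

Local Open Scope classical_set_scope.

(* A partial function from X to Y is a total function X -> option Y, with None
   meaning "undefined"; Leibniz equality is then equality of domains and of
   values. *)
Notation "X -o-> Y" := (X -> option Y) (at level 99, Y at level 200) : type_scope.

Definition pdom (X Y : Type) (F : X -o-> Y) : set X := [set x | F x <> None].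

(* Continuity on [pdom F] with the subspace topology: the preimage of an open
   set is the trace on [pdom F] of an open set. *)
Definition pcontinuous (X Y : topologicalType) (F : X -o-> Y) : Prop :=
  forall V : set Y, open V ->
    exists2 U : set X, open U & F @^-1` (Some @` V) = U `&` pdom F.

Record problem := Problem {
  pin : topologicalType;
  pout : topologicalType;
  psols : set (pin -o-> pout) }.
Arguments psols : clear implicits.

(* x |-> F (x, g (G x)), defined exactly where all the terms are. *)
Definition reduce (X1 X2 Y1 Y2 : Type) (F : X1 * Y2 -o-> Y1) (G : X1 -o-> X2)
    (g : X2 -o-> Y2) : X1 -o-> Y1 :=
  fun x => obind (fun u => obind (fun y => F (x, y)) (g u)) (G x).

Definition le2 (P Q : problem) : Prop :=
  exists (F : (pin P * pout Q)%type -o-> pout P) (G : pin P -o-> pin Q),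
    [/\ pcontinuous F, pcontinuous G &
        forall g, psols Q g -> psols P (reduce F G g)].

(* {i & X i} carries the coproduct topology (sigT_topology.v). *)
Definition coprod_pfun (I : Type) (X Y : I -> Type)
    (f : forall i, X i -o-> Y i) : {i & X i} -o-> {i & Y i} :=
  fun p => omap (existT Y (projT1 p)) (f (projT1 p) (projT2 p)).

Definition coprod_problem (I : choiceType) (P : I -> problem) : problem :=
  @Problem {i & pin (P i)} {i & pout (P i)}
    [set h | exists2 f : (forall i, pin (P i) -o-> pout (P i)),
               (forall i, psols (P i) (f i)) & h = coprod_pfun f].

Definition equiv2 (P Q : problem) : Prop := le2 P Q /\ le2 Q P.

(* [set] is confined to the universe of the carriers of topological spaces,
   which [problem] exceeds; classes are plain predicates. *)
Definition PP2 :=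
  {C : problem -> Prop | exists P, C = (fun Q => equiv2 P Q)}.

Definition class2 (P : problem) : PP2 :=
  exist _ (fun Q => equiv2 P Q) (ex_intro _ P erefl).

Definition lePP2 (C D : PP2) : Prop :=
  exists P Q, [/\ sval C P, sval D Q & le2 P Q].

Definition partial_order (T : Type) (le : T -> T -> Prop) : Prop :=
  [/\ forall x, le x x,
      forall x y z, le x y -> le y z -> le x z &
      forall x y, le x y -> le y x -> x = y].

Definition is_lub (T : Type) (le : T -> T -> Prop) (S : T -> Prop) (s : T) :
    Prop :=
  (forall x, S x -> le x s) /\
  (forall u, (forall x, S x -> le x u) -> le s u).

(* A subset of a class T, as opposed to a subclass, is a collection indexed by
   a type in the universe of the carriers of choiceType and topologicalType. *)
Definition is_small (T : Type) (S : T -> Prop) : Prop :=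
  exists (I : choiceType) (f : I -> T), S = (fun x => exists i, x = f i).

Definition complete_join_semilattice (T : Type) (le : T -> T -> Prop) : Prop :=
  partial_order le /\
  forall S : T -> Prop, is_small S -> exists s, is_lub le S s.

(* Main.v *)
Require Import Defs.
From HB Require Import structures.
From mathcomp Require Import all_boot all_order all_algebra.
From mathcomp Require Import all_classical topology.

(** Continuity of a partial function is local on its domain, and on a coproduct
    locality means summand by summand.  Hence the reduction of [P j] to the
    coproduct injects the input into summand [j] and reads off outputs lying in
    the open summand [j], while reductions [(F i, G i)] of the [P i] to [Q]
    glue to a single reduction of the coproduct. *)

Set Implicit Arguments.
Unset Strict Implicit.

Local Open Scope classical_set_scope.

(** Lets continuity be checked with neighbourhood filters. Points where [F] is undefined satisfy the
    condition vacuously, which is what the subspace topology on [pdom F] amounts to. *)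
Lemma pcontinuousP (X Y : topologicalType) (F : X -o-> Y) :
  pcontinuous F <->
  forall x y, F x = Some y -> forall V, nbhs y V ->
    \forall x' \near x, forall y', F x' = Some y' -> V y'.
Proof.
split=> [cF x y Fxy V|cF V oV].
- rewrite nbhsE => -[W [oW Wy] WV].
  have [U oU FU] := cF W oW.
  have Ux : U x.
    suff : (U `&` pdom F) x by case.
    by rewrite -FU; exists y.
  apply: filterS (open_nbhs_nbhs (conj oU Ux)) => x' Ux' y' Fx'.
  have : (U `&` pdom F) x' by split=> //; rewrite /pdom/= Fx'.
  by rewrite -FU => -[z Wz]; rewrite Fx' => -[<-]; exact: WV.
(* This is the largest open set whose trace on [pdom F] lies in the preimage of [V]; the undefined
   points it admits are cut off by the trace. *)
- exists (interior [set x | forall y, F x = Some y -> V y]).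
    exact: open_interior.
  apply/seteqP; split=> [x [y Vy Fxy]|x [/interior_subset Ux]].
    split; last by rewrite /pdom/= -Fxy.
    by apply: (cF x y) => //; exact: open_nbhs_nbhs.
  by rewrite /pdom/=; case Fx : (F x) => [y|//] _; exists y => //; exact: Ux.
Qed.

Lemma continuous_pcontinuous (X Y : topologicalType) (f : X -> Y) :
  continuous f -> pcontinuous (fun x => Some (f x)).
Proof.
move=> cf; apply/pcontinuousP => x _ [<-] V nV.
have nfV : nbhs x (f @^-1` V) := cf x V nV.
by apply: filterS nfV => x' Vx' _ [<-].
Qed.

Lemma pcontinuous_comp (X Y Z : topologicalType) (F : X -o-> Y) (G : Y -o-> Z) :
  pcontinuous F -> pcontinuous G -> pcontinuous (fun x => obind G (F x)).
Proof.
move=> /pcontinuousP cF /pcontinuousP cG; apply/pcontinuousP => x z.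
case Fx : (F x) => [y|//] /= Gy V nV.
apply: filterS (cF _ _ Fx _ (cG _ _ Gy _ nV)) => x'.
by case: (F x') => [y'|//] /(_ _ erefl) /= h z'; exact: h.
Qed.

Lemma pcontinuous_pair (X Y Z : topologicalType) (F : X -o-> Y) (G : X -o-> Z) :
  pcontinuous F -> pcontinuous G ->
  pcontinuous (fun x => obind (fun y => omap (pair y) (G x)) (F x)).
Proof.
move=> /pcontinuousP cF /pcontinuousP cG; apply/pcontinuousP => x yz.
case Fx : (F x) => [y|//]; case Gx : (G x) => [z|//] /= [<-] V.
move=> [[A B] /= [nA nB] ABV].
apply: filterS2 (cF _ _ Fx _ nA) (cG _ _ Gx _ nB) => x'.
case: (F x') => [y'|//]; case: (G x') => [z'|//] /= /(_ _ erefl) Ay.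
by move=> /(_ _ erefl) Bz _ [<-]; exact: ABV.
Qed.

(** A neighbourhood of [existT _ i x] is a set whose preimage under [existT _ i] is a neighbourhood
    of [x], so continuity at that point is, by conversion, continuity of [G i] at [x]. *)
Lemma pcontinuous_sigT (I : choiceType) (X : I -> topologicalType)
    (Y : topologicalType) (G : forall i, X i -o-> Y) :
  (forall i, pcontinuous (G i)) ->
  pcontinuous (fun p : {i & X i} => G (projT1 p) (projT2 p)).
Proof.
by move=> cG; apply/pcontinuousP => -[i x] y /= /((pcontinuousP _).1 (cG i)).
Qed.

(** A box around a point of [X i * Z] stays a box once its first side is pushed into the coproduct,
    because summands are open. All its points have index [i], so only [F i] is evaluated there. *)
Lemma pcontinuous_sigT_prod (I : choiceType) (X : I -> topologicalType)
    (Z Y : topologicalType) (F : forall i, (X i * Z)%type -o-> Y) :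
  (forall i, pcontinuous (F i)) ->
  pcontinuous
    (fun p : {i & X i} * Z => F (projT1 p.1) (projT2 p.1, p.2)).
Proof.
move=> cF; apply/pcontinuousP => -[[i x] z] y /=.
move=> /((pcontinuousP _).1 (cF i)) h V /h [[A B] /= [nA nB] ABV].
exists (existT X i @` A, B); first by split=> //=; exact: existT_nbhs.
by move=> [_ z'] /= [[x' Ax' <-] Bz']; exact: (ABV (x', z')).
Qed.

Section Summand.
Variables (I : choiceType) (X : I -> topologicalType) (j : I).

(** The partial inverse of [existT _ j]. Its value must be transported along a proof that the index
    is [j], and that equality is decided classically. *)
Definition sigT_summand (p : {i & X i}) : option (X j) :=
  if pselect (projT1 p = j) is left e then Some (eq_rect _ X (projT2 p) _ e)
  else None.

Lemma sigT_summand_existT (x : X j) : sigT_summand (existT _ j x) = Some x.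
Proof.
rewrite /sigT_summand; case: pselect => //= e.
(* Here [e : j = j], and proof irrelevance makes the transport the identity. *)
by rewrite (Prop_irrelevance e erefl).
Qed.

Lemma sigT_summandP (p : {i & X i}) (x : X j) :
  sigT_summand p = Some x -> p = existT _ j x.
Proof.
by rewrite /sigT_summand; case: pselect => // e [<-]; case: p e => i y /= e;
  case: _ / e.
Qed.

Lemma pcontinuous_sigT_summand : pcontinuous sigT_summand.
Proof.
apply/pcontinuousP => p x /sigT_summandP -> V nV.
apply: filterS (existT_nbhs _ _ _ nV) => _ [x' Vx' <-] x''.
by rewrite sigT_summand_existT => -[<-].
Qed.

End Summand.

Lemma le2_refl (P : problem) : le2 P P.
Proof.
exists (fun p => Some p.2), Some; split=> [||g].
- by apply: continuous_pcontinuous => p; exact: cvg_snd.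
- by apply: continuous_pcontinuous => x; exact: cvg_id.
- suff -> : reduce (fun p : pin P * pout P => Some p.2) Some g = g by [].
  by apply/funext => x; rewrite /reduce/=; case: (g x).
Qed.

Lemma le2_trans (P Q R : problem) : le2 P Q -> le2 Q R -> le2 P R.
Proof.
move=> [F1 [G1 [cF1 cG1 h1]]] [F2 [G2 [cF2 cG2 h2]]].
have cfst : pcontinuous (fun p : pin P * pout R => Some p.1).
  by apply: continuous_pcontinuous => p; exact: cvg_fst.
have csnd : pcontinuous (fun p : pin P * pout R => Some p.2).
  by apply: continuous_pcontinuous => p; exact: cvg_snd.
(* The inner map sends [(x, y)] to [F2 (G1 x, y)]; the next step forms [F1 (x, F2 (G1 x, y))]. The
   witness [F] is read off from this continuity proof. *)
have cin := pcontinuous_comp (pcontinuous_pair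
  (pcontinuous_comp cfst cG1) csnd) cF2.
have := pcontinuous_comp (pcontinuous_pair cfst cin) cF1.
set F := (F in pcontinuous F) => cF.
exists F, (fun x => obind G2 (G1 x)); split=> //; first exact: pcontinuous_comp.
move=> g /h2 /h1; congr (psols P); apply/funext => x.
rewrite /reduce /F /=; case: (G1 x) => [u|//] /=; case: (G2 u) => [v|//] /=.
by case: (g v) => [y|//] /=; case: (F2 _).
Qed.

Lemma le2_coprod (I : choiceType) (P : I -> problem) (j : I) :
  le2 (P j) (coprod_problem P).
Proof.
exists (fun p => sigT_summand j p.2), (fun x => Some (existT _ j x)); split.
- apply: (@pcontinuous_comp _ _ _ (fun p => Some p.2)).
    by apply: continuous_pcontinuous => p; exact: cvg_snd.
  exact: pcontinuous_sigT_summand.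
- exact: continuous_pcontinuous (existT_continuous j).
(* The reduction recovers the component [f j] exactly, domain included. *)
- move=> _ [f fP ->]; move: (fP j); congr (psols (P j)); apply/funext => x.
  rewrite /reduce /coprod_pfun /=; case: (f j x) => [y|//] /=.
  by rewrite sigT_summand_existT.
Qed.

Lemma coprod_le2 (I : choiceType) (P : I -> problem) (Q : problem) :
  (forall i, le2 (P i) Q) -> le2 (coprod_problem P) Q.
Proof.
(* Choice fixes one reduction for every index at once. *)
move=> PQ; pose F i := sval (cid (PQ i)); have FP i := svalP (cid (PQ i)).
pose G i := sval (cid (FP i)).
have cF i : pcontinuous (F i) by case: (svalP (cid (FP i))).
have cG i : pcontinuous (G i) by case: (svalP (cid (FP i))).
have FG i g : psols Q g -> psols (P i) (reduce (F i) (G i) g).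
  by case: (svalP (cid (FP i))) => _ _; exact.
(* Tagging outputs with their index gives all the [F i] the same codomain, as gluing requires. *)
pose F' i p := obind (fun y => Some (existT (fun i => pout (P i)) i y)) (F i p).
exists (fun p => F' (projT1 p.1) (projT2 p.1, p.2)).
exists (fun p => G (projT1 p) (projT2 p)); split.
- apply: (@pcontinuous_sigT_prod _ _ _ _ F') => i.
  apply: (pcontinuous_comp (cF i)).
  exact: continuous_pcontinuous (existT_continuous i).
- exact: pcontinuous_sigT.
(* A single [g] yields a solution of each [P i], and any family of such solutions forms a solution
   of the coproduct. *)
- move=> g Qg; exists (fun i => reduce (F i) (G i) g) => [i|]; first exact: FG.
  apply/funext => -[i x]; rewrite /reduce /coprod_pfun /F' /=.
  by case: (G i x) => [u|//] /=; case: (g u).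
Qed.

Lemma PP2_class2 (C : PP2) : exists P, C = class2 P.
Proof. by case: C => C [P CP]; exists P; exact: eq_exist. Qed.

Lemma lePP2_class2 (P Q : problem) : lePP2 (class2 P) (class2 Q) <-> le2 P Q.
Proof.
split=> [[P' [Q' [/= [PP' _] [_ Q'Q] PQ']]]|PQ].
  exact: le2_trans (le2_trans PP' PQ') Q'Q.
by exists P, Q; split=> //; split; exact: le2_refl.
Qed.

Lemma class2_eq (P Q : problem) : le2 P Q -> le2 Q P -> class2 P = class2 Q.
Proof.
move=> PQ QP; apply: eq_exist; apply/funext => R; apply/propext.
by split=> -[hl hr]; split; (exact: le2_trans PQ _ || exact: le2_trans QP _ ||
  exact: le2_trans hr PQ || exact: le2_trans hr QP).
Qed.

Lemma lePP2_partial_order : partial_order lePP2.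
Proof.
split=> [x|x y z|x y]; have [P ->] := PP2_class2 x.
- exact/lePP2_class2/le2_refl.
- have [Q ->] := PP2_class2 y; have [R ->] := PP2_class2 z.
  by rewrite !lePP2_class2; exact: le2_trans.
- by have [Q ->] := PP2_class2 y; rewrite !lePP2_class2; exact: class2_eq.
Qed.

Lemma is_lub_coprod (I : choiceType) (P : I -> problem) :
  is_lub lePP2 (fun C => exists i : I, C = class2 (P i))
    (class2 (coprod_problem P)).
Proof.
split=> [_ [i ->]|u]; first exact/lePP2_class2/le2_coprod.
have [Q ->] := PP2_class2 u => PQ; apply/lePP2_class2/coprod_le2 => i.
by apply/lePP2_class2/PQ; exists i.
Qed.

Theorem theorem4p9 :
  (forall (I : choiceType) (P : I -> problem),
     (forall j : I, le2 (P j) (coprod_problem P)) /\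
     (forall Q : problem,
        (forall i : I, le2 (P i) Q) -> le2 (coprod_problem P) Q)) /\
  complete_join_semilattice lePP2 /\
  (forall (S : PP2 -> Prop) (I : choiceType) (P : I -> problem),
     S = (fun C => exists i : I, C = class2 (P i)) ->
     is_lub lePP2 S (class2 (coprod_problem P))).
Proof.
split=> [I P|]; first by split; [exact: le2_coprod | exact: coprod_le2].
split=> [|S I P ->]; last exact: is_lub_coprod.
split=> [|_ [I [f ->]]]; first exact: lePP2_partial_order.
(* Choosing representatives turns the family of classes into a family of problems, whose coproduct
   can be formed. *)
have [P fP] := choice (fun i => PP2_class2 (f i)).
exists (class2 (coprod_problem P)).
have -> : f = fun i => class2 (P i) by exact/funext.
exact: is_lub_coprod.
Qed.
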